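(* Let $\mathcal{A} \subseteq M_n$ be an operator algebra. The following are equivalent: (i) there is an ordered orthonormal basis of $\mathbb{C}^n$ with respect to which every operator in $\mathcal{A}$ has an upper triangular matrix; (ii) there is an ordered vector space basis of $\mathbb{C}^n$ with respect to which every operator in $\mathcal{A}$ has an upper triangular matrix; (iii) $\mathcal{A}$ has no full subquotients of dimension greater than $1$.
   Context: $M_n = M_n(\mathbb{C})$ is identified with the linear operators on the Hilbert space $\mathbb{C}^n$. An operator algebra in $M_n$ is a complex linear subspace closed under products (not necessarily unital or self-adjoint). A subspace $\mathcal{E}\subseteq\mathbb{C}^n$ is invariant for $\mathcal{A}$ if $A(\mathcal{E})\subseteq\mathcal{E}$ for all $A\in\mathcal{A}$; it is semi-invariant for $\mathcal{A}$ if $\mathcal{E} = \mathcal{E}_1 \ominus \mathcal{E}_2 = \mathcal{E}_1\cap\mathcal{E}_2^\perp$ for some invariant subspaces $\mathcal{E}_2\subseteq\mathcal{E}_1$. A subquotient of $\mathcal{A}$ is a set of the form $P\mathcal{A}P$, regarded as a subset of $B(\mathcal{E})$ (it is then an operator algebra), where $P$ is the orthogonal projection onto a semi-invariant subspace $\mathcal{E}$. The subquotient is full if it equals $B(\mathcal{E})$. Thus (iii) says that there is no semi-invariant subspace $\mathcal{E}$ with $\dim \mathcal{E}>1$ and $P\mathcal{A}P = B(\mathcal{E})$. *)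

(* Defs.v *)
From HB Require Import structures.
From mathcomp Require Import all_boot all_order all_algebra.
From mathcomp Require Import reals complex.

Set Implicit Arguments.
Unset Strict Implicit.
Unset Printing Implicit Defensive.

Import Order.TTheory GRing.Theory Num.Theory.
Local Open Scope ring_scope.

Section ColumnDot.
Variables (C : numClosedFieldType) (n : nat).
Implicit Types (u v : 'cV[C]_n).

(* [dotmx] of spectral.v is the inner product of row vectors; operators act
   here on columns. *)
Definition dotcv u v : C := dotmx u^T v^T.

Lemma dotcvE u v : dotcv u v = \sum_i u i 0 * (v i 0)^*.
Proof. by rewrite /dotcv dotmxE mxE; apply: eq_bigr => i _; rewrite !mxE. Qed.

Fact dotcv_bilinear : bilinear_for *%R (Num.conj \; *%R) dotcv.
Proof.
split=> [u|u] a x y /=; rewrite !dotcvE mulr_sumr -big_split;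
  apply: eq_bigr => i _; rewrite /= !mxE ?rmorphD ?rmorphM /=.
- by rewrite mulrDl mulrA.
- by rewrite mulrDr mulrCA.
Qed.

HB.instance Definition _ := bilinear_isBilinear.Build C 'cV[C]_n 'cV[C]_n C
  *%R (Num.conj \; *%R) dotcv dotcv_bilinear.

Fact dotcv_hermitian u v : dotcv u v = (-1) ^+ false * (dotcv v u)^*.
Proof.
rewrite expr0 mul1r !dotcvE rmorph_sum; apply: eq_bigr => i _ /=.
by rewrite rmorphM /= conjCK mulrC.
Qed.

HB.instance Definition _ := isHermitianSesquilinear.Build C 'cV[C]_n
  false Num.conj dotcv dotcv_hermitian.

Fact dotcv_gt0 u : u != 0 -> 0 < dotcv u u.
Proof.
by move=> u0; apply: dotmx_is_dotmx; rewrite -trmx0 (inj_eq trmx_inj).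
Qed.

HB.instance Definition _ := isDotProduct.Build C 'cV[C]_n dotcv dotcv_gt0.

End ColumnDot.

Section OperatorAlgebras.
Variables (C : numClosedFieldType) (n : nat).
Implicit Types (A : {vspace 'M[C]_n}) (E : {vspace 'cV[C]_n}).

Definition operator_algebra A := {in A &, forall a b, a *m b \in A}.

Definition invariant_subspace A E :=
  forall a x, a \in A -> x \in E -> a *m x \in E.

Definition semi_invariant_subspace A E :=
  exists E1 E2 : {vspace 'cV[C]_n},
    [/\ invariant_subspace A E1, invariant_subspace A E2, (E2 <= E1)%VS
      & E = (E1 :&: orthov (@dotcv C n) E2)%VS].

Definition orth_proj E : 'End('cV[C]_n) := daddv_pi E (orthov (@dotcv C n) E).

Lemma orthov_disjoint E : (E :&: orthov (@dotcv C n) E = 0)%VS.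
Proof.
apply/eqP; rewrite -subv0; apply/subvP => y.
rewrite memv_cap memv0 => /andP[yE /mem_orthovP/(_ y yE) yy0].
by apply/negPn/negP => /dotcv_gt0; rewrite yy0 ltxx.
Qed.

Lemma orth_proj_id E x : x \in E -> orth_proj E x = x.
Proof. exact/daddv_pi_id/orthov_disjoint. Qed.

Lemma orth_proj_0 E x : x \in orthov (@dotcv C n) E -> orth_proj E x = 0.
Proof.
move=> xE; apply: (addIr x); rewrite add0r.
have xS : x \in (E + orthov (@dotcv C n) E)%VS by exact: (subvP (addvSr _ _)).
rewrite -{3}(daddv_pi_add (orthov_disjoint E) xS); congr (_ + _).
by rewrite daddv_pi_id // capvC orthov_disjoint.
Qed.

(* P a P regarded as an operator on E, i.e. x |-> P (a x) for x in E. *)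
Definition compress E (a : 'M[C]_n) : 'End(subvs_of E) :=
  linfun (vsproj E \o orth_proj E \o mulmx a \o vsval).

Lemma compressE E a x : vsval (compress E a x) = orth_proj E (a *m vsval x).
Proof. by rewrite lfunE /= vsprojK // memv_pi. Qed.

Fact compress_is_linear E : linear (compress E).
Proof.
move=> c a b; apply/lfunP => x; apply/val_inj.
rewrite add_lfunE scale_lfunE (linearP vsval) /= !compressE.
by rewrite mulmxDl -scalemxAl linearP.
Qed.

HB.instance Definition _ E := GRing.isLinear.Build C 'M[C]_n
  'End(subvs_of E) _ (compress E) (@compress_is_linear E).

Definition subquotient A E : {vspace 'End(subvs_of E)} :=
  (linfun (compress E) @: A)%VS.

Lemma mem_subquotientP A E T :
  reflect (exists2 a, a \in A & T = compress E a) (T \in subquotient A E).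
Proof.
by apply: (iffP memv_imgP) => -[a aA ->]; exists a; rewrite // lfunE.
Qed.

Definition full_subquotient A E := subquotient A E = fullv.

(* The matrix acting on columns of coordinates: column j holds the
   coordinates of a *m b_j. *)
Definition matrix_in_basis (b : n.-tuple 'cV[C]_n) (a : 'M[C]_n) : 'M[C]_n :=
  \matrix_(i, j) coord b i (a *m b`_j).

(* [is_trig_mx] means lower triangular. *)
Definition upper_triangular_mx (M : 'M[C]_n) := is_trig_mx M^T.

Lemma upper_triangular_mxP (M : 'M[C]_n) :
  reflect (forall i j : 'I_n, (j < i)%N -> M i j = 0) (upper_triangular_mx M).
Proof.
by apply: (iffP is_trig_mxP) => h i j ij; have := h _ _ ij; rewrite mxE.
Qed.

Definition triangularized_by A (b : n.-tuple 'cV[C]_n) :=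
  {in A, forall a, upper_triangular_mx (matrix_in_basis b a)}.

Definition orthonormal_basis (b : n.-tuple 'cV[C]_n) :=
  basis_of fullv b && orthonormal (@dotcv C n) b.

End OperatorAlgebras.

(* Main.v *)
Require Import Defs.
From HB Require Import structures.
From mathcomp Require Import all_boot all_order all_algebra.
From mathcomp Require Import reals complex.
From mathcomp Require boolp.

Set Implicit Arguments.
Unset Strict Implicit.
Unset Printing Implicit Defensive.

Import Order.TTheory GRing.Theory Num.Theory.
Import passmx.
Local Open Scope ring_scope.

(** If [b] triangularizes the algebra, a commutator of two of its elements maps
    the span of the first [k + 1] vectors of [b] into that of the first [k].
    A full subquotient [E1 :&: E2^_|_] of dimension greater than 1 provides a
    commutator fixing some nonzero [x] in it modulo [E2], and descending along
    the flag forces [x] into [E2].  Conversely, between an invariant subspace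
    and a minimal invariant one strictly above it the compressed algebra is
    irreducible, hence full in dimension greater than 1 by Burnside's theorem;
    without full subquotients the dimension therefore grows by one at each step,
    and a unit vector orthogonal to the previous space extends the basis.

    Burnside's theorem follows Halperin and Rosenthal: if [f] has rank at least
    2, transitivity gives [a] such that [f a f] is not a multiple of [f], and an
    eigenvalue [c] of [f a] on the range of [f] makes [f a f - c f] a nonzero
    element of smaller rank.  Composing a rank-one element on both sides then
    yields every operator of rank one. *)

(** * Separating families of linear forms, and eigenvectors in stable subspaces *)

Section LinearForms.
Variables (K : fieldType) (V : vectType K).

Lemma dim_lker_form (U : {vspace V}) (phi : 'Hom(V, K^o)) :
  ((\dim U).-1 <= \dim (U :&: lker phi))%N.
Proof.
have /dimvS := subvf (phi @: U)%VS; rewrite dimvf /= => dim_img.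
by rewrite -(limg_ker_dim phi U) -subn1 leq_subLR addnC leq_add2r.
Qed.

(** Each form of a basis of [D] lowers the dimension of the common kernel by at most one. That
    kernel is zero by hypothesis, so [D] has at least as many dimensions as [V]. *)
Lemma separating_forms_full (D : {vspace 'Hom(V, K^o)}) :
  (forall v, (forall phi, phi \in D -> phi v = 0) -> v = 0) -> D = fullv.
Proof.
move=> sepD; apply/eqP; rewrite eqEdim subvf /= dimvf.
pose annih (s : seq 'Hom(V, K^o)) := foldr (fun phi U => U :&: lker phi)%VS fullv s.
have annihP s v : v \in annih s -> {in s, forall phi : 'Hom(V, K^o), phi v = 0}.
  elim: s => //= phi s IHs; rewrite memv_cap memv_ker => /andP[/IHs vs /eqP phiv].
  by move=> psi /predU1P[->|/vs].
have dim_annih s : (\dim {:V} - size s <= \dim (annih s))%N.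
  elim: s => [|phi s IHs] /=; first by rewrite subn0.
  apply: leq_trans (dim_lker_form _ _).
  by rewrite subnS -!subn1 leq_sub2r.
have := dim_annih (vbasis D); rewrite size_tuple.
suff -> : annih (vbasis D) = 0%VS.
  by rewrite dimv0 leqn0 subn_eq0 dimvf /dim /= muln1.
apply/eqP; rewrite -subv0; apply/subvP => v /annihP vs; rewrite memv0.
apply/eqP/sepD => phi /coord_vbasis ->.
rewrite sum_lfunE big1 // => i _.
by rewrite scale_lfunE vs ?scaler0 // mem_nth // size_tuple.
Qed.

End LinearForms.

Section LeftComposition.
Variables (K : fieldType) (U V W : vectType K) (f : 'Hom(V, W)).

Definition lcomp (g : 'Hom(U, V)) : 'Hom(U, W) := (f \o g)%VF.

Fact lcomp_is_linear : linear lcomp.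
Proof. by move=> c g h; rewrite /lcomp comp_lfunDr comp_lfunZr. Qed.

HB.instance Definition _ := GRing.isLinear.Build K 'Hom(U, V) 'Hom(U, W) _
  lcomp lcomp_is_linear.

End LeftComposition.

(** The restriction of [f] to [W] has a matrix of positive size over a closed field, hence an
    eigenvalue. *)
Lemma stable_eigenvector (C : numClosedFieldType) (V : vectType C)
    (f : 'End(V)) (W : {vspace V}) :
    W != 0%VS -> (f @: W <= W)%VS ->
  exists c, exists w, [/\ w \in W, w != 0 & f w = c *: w].
Proof.
move=> W0 fW; pose g : 'End(subvs_of W) := linfun (vsproj W \o f \o vsval).
pose e := vbasis {:subvs_of W}.
have dW : (0 < \dim {:subvs_of W})%N by rewrite dimvf lt0n dimv_eq0.
have [c] := eigenvalue_closed (mxof e e g) dW.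
rewrite /eigenvalue => cP; exists c.
have : leigenspace g c != 0%VS.
  by rewrite (leigenspaceE (vbasisP _)) (vsof_eq0 (vbasisP _)).
rewrite -vpick0; set w := vpick _ => w0; exists (vsval w); split.
- exact: subvsP.
- by apply: contra w0 => /eqP w0; apply/eqP/val_inj.
have : w \in leigenspace g c by exact: memv_pick.
rewrite memv_ker add_lfunE opp_lfunE scale_lfunE id_lfunE subr_eq0 => /eqP.
move/(congr1 vsval); rewrite lfunE /= vsprojK // .
by apply: (subvP fW); rewrite memv_img // subvsP.
Qed.

(** * Burnside's theorem for irreducible algebras of operators *)

Section Burnside.
Variables (C : numClosedFieldType) (V : vectType C) (B : {vspace 'End(V)}).

Definition eval_at (v : V) (f : 'End(V)) : V := f v.

Fact eval_at_is_linear v : linear (eval_at v).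
Proof. by move=> c f g; rewrite /eval_at add_lfunE scale_lfunE. Qed.

HB.instance Definition _ v :=
  GRing.isLinear.Build C 'End(V) V _ (eval_at v) (@eval_at_is_linear v).

Hypothesis dimV : (1 < \dim {:V})%N.
Hypothesis mulB : {in B &, forall f g, (f \o g)%VF \in B}.
Hypothesis irrB : forall W : {vspace V},
  (forall f w, f \in B -> w \in W -> f w \in W) -> W = 0%VS \/ W = fullv.

(** The orbit of [v] is invariant. Were it zero, the line through [v] would be a proper nonzero
    invariant subspace, as [V] has dimension greater than 1. *)
Lemma irreducible_transitive v w : v != 0 -> exists2 f, f \in B & f v = w.
Proof.
move=> v0; pose Bv := (linfun (eval_at v) @: B)%VS.
have BvP f : f \in B -> f v \in Bv.
  by move=> fB; apply/memv_imgP; exists f; rewrite // lfunE.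
have [f x fB /memv_imgP[g gB ->]|Bv0|Bvf] := irrB (W := Bv).
- by rewrite lfunE /= /eval_at -comp_lfunE BvP // mulB.
- have fv0 f : f \in B -> f v = 0.
    by move/BvP; rewrite Bv0 memv0 => /eqP.
  have [f x fB /vlineP[k ->]|/eqP|h] := irrB (W := <[v]>%VS).
  + by rewrite linearZ /= fv0 // scaler0 mem0v.
  + by rewrite -dimv_eq0 dim_vline v0.
  by move: dimV; rewrite -h dim_vline v0.
have : w \in Bv by rewrite Bvf memvf.
by case/memv_imgP => f fB ->; exists f; rewrite // lfunE.
Qed.

Lemma irreducible_rank_one : exists2 f, f \in B & \dim (limg f) = 1%N.
Proof.
have [v v0] : exists v : V, v != 0.
  exists (vpick fullv); rewrite vpick0 -dimv_eq0 -lt0n; exact: ltnW.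
have [f fB fv] := irreducible_transitive v v0.
have f0 : f != 0 by apply: contra_neq v0 => f0; rewrite -fv f0 zero_lfunE.
have [k] := ubnP (\dim (limg f)).
elim: k f fB f0 {v v0 fv} => // k IHk f fB f0; rewrite ltnS => fk.
have /lfunPn[x1] := f0; rewrite zero_lfunE => y10; set y1 := f x1 in y10.
have [f1|] := boolP (limg f <= <[y1]>)%VS.
  exists f => //; apply/eqP; rewrite eqn_leq; apply/andP; split.
    by rewrite (leq_trans (dimvS f1)) // dim_vline y10.
  rewrite lt0n dimv_eq0; apply: contra y10 => /eqP limf.
  by rewrite -memv0 -limf memv_img ?memvf.
case/subvPn => _ /memv_imgP[x2 _ ->] y2.
have [a aB ay1] := irreducible_transitive x2 y10.
have f_stable : ((f \o a) @: limg f <= limg f)%VS.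
  by rewrite limg_comp limgS ?subvf.
have limf0 : limg f != 0%VS.
  by apply: contraNneq y10 => limf; rewrite -memv0 -limf memv_img ?memvf.
have [c [w [wf w0 fw]]] := stable_eigenvector limf0 f_stable.
pose p : 'End(V) := (f \o a - c *: \1)%VF.
have pE z : p z = f (a z) - c *: z.
  by rewrite add_lfunE opp_lfunE scale_lfunE id_lfunE comp_lfunE.
have hE : (p \o f)%VF = (f \o (a \o f) - c *: f)%VF.
  by apply/lfunP => z; rewrite !lfunE /= pE opp_lfunE scale_lfunE !lfunE /= lfunE.
apply: (IHk (p \o f)%VF).
- by rewrite hE memvB ?memvZ // !mulB.
(* At [x1] the value is [f x2 - c *: y1], nonzero because [f x2] lies off the line of [y1]. *)
- apply/lfunPn; exists x1; rewrite zero_lfunE comp_lfunE pE -/y1 ay1 subr_eq0.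
  by apply: contra y2 => /eqP ->; rewrite memvZ ?memv_line.
(* The rank drops since [p] kills the nonzero vector [w] of the range of [f]. *)
apply: leq_trans fk; rewrite -(limg_ker_dim p (limg f)) limg_comp -[X in (X < _)%N]add0n.
rewrite ltn_add2r lt0n dimv_eq0; apply: contra w0 => /eqP ker0.
by rewrite -memv0 -ker0 memv_cap wf memv_ker pE -comp_lfunE fw subrr eqxx.
Qed.

Theorem burnside : B = fullv.
Proof.
have [f fB f1] := irreducible_rank_one.
pose u := vpick (limg f).
have u0 : u != 0 by rewrite vpick0 -dimv_eq0 f1.
have limf : limg f = <[u]>%VS.
  apply/esym/eqP; rewrite eqEdim dim_vline u0 f1 andbT -memvE; exact: memv_pick.
pose phi : 'Hom(V, C^o) :=
  (linfun (coord [tuple u] 0 : V -> C^o) \o f)%VF.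
have phiE x : f x = phi x *: u.
  have : f x \in <<[tuple u]>>%VS by rewrite span_seq1 -limf memv_img ?memvf.
  by move/coord_span; rewrite big_ord1 comp_lfunE lfunE.
have dualB : forall psi : 'Hom(V, C^o), exists2 b, b \in B & forall x, psi x = phi (b x).
  move=> psi; suff : psi \in (linfun (lcomp phi) @: B)%VS.
    case/memv_imgP => b bB ->; exists b => // x.
    by rewrite lfunE comp_lfunE.
  (* The forms [lcomp phi b] separate points: transitivity carries a nonzero [v] to a vector where
     [phi] does not vanish. *)
  suff -> : (linfun (lcomp phi) @: B)%VS = fullv by rewrite memvf.
  apply: separating_forms_full => v Lv.
  apply/eqP; apply: contraTT isT => v0.
  case/eqP: u0; have : u \in limg f by exact: memv_pick.
  case/memv_imgP => w _ ->; rewrite phiE.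
  have [b bB <-] := irreducible_transitive w v0.
  have -> : phi (b v) = 0; last by rewrite scale0r.
  have := Lv (lcomp phi b); rewrite comp_lfunE; apply.
  by apply/memv_imgP; exists b; rewrite // lfunE.
have rank1B (psi : 'Hom(V, C^o)) y : exists2 g, g \in B & forall x, g x = psi x *: y.
  have [b bB psiE] := dualB psi; have [a aB <-] := irreducible_transitive y u0.
  exists (a \o (f \o b))%VF; first by rewrite !mulB.
  by move=> x; rewrite !comp_lfunE phiE -psiE linearZ.
apply/vspaceP => T; rewrite memvf; pose e := vbasis {:V}.
(* Expanding the argument in the basis [e] makes [T] a sum of operators of rank at most one. *)
have [g gB gE] := fin_all_exists2
  (fun i => rank1B (linfun (coord e i : V -> C^o)) (T e`_i)).
suff -> : T = \sum_i g i by exact: memv_suml.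
apply/lfunP => x; rewrite {1}(coord_vbasis (memvf x)) sum_lfunE linear_sum.
by apply: eq_bigr => i _; rewrite gE lfunE linearZ.
Qed.

End Burnside.

Lemma lfun_commutator_fixes_vector (K : fieldType) (V : vectType K) :
    (1 < \dim {:V})%N ->
  exists f : 'End(V), exists g : 'End(V), exists x : V,
    x != 0 /\ f (g x) - g (f x) = x.
Proof.
move=> dV; pose e := vbasis {:V}; have be : basis_of {:V} e := vbasisP _.
pose i0 := Ordinal (ltnW dV); pose i1 := Ordinal dV.
(* Matrices act here on row vectors, so [delta_mx j i] sends the [j]-th basis vector to the [i]-th.
   The two operators below exchange the roles of [i0] and [i1], and only one of the two products is
   nonzero on the vector of index [i0]. *)
have opE (i j k : 'I_(\dim {:V})) :
    hommx e e (delta_mx j i) e`_k = (k == j)%:R *: e`_i.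
  rewrite (hommxE be) // (rVofE be) mul_delta_mx_cond -scaler_nat linearZ /=.
  by rewrite vecof_delta.
exists (hommx e e (delta_mx i1 i0)), (hommx e e (delta_mx i0 i1)), e`_i0; split.
  by apply: (basis_not0 be); rewrite mem_nth // size_tuple.
by rewrite !opE !scale1r scale0r linear0 subr0 opE scale1r.
Qed.

(** * Orthogonal complements in the column space *)

Section OrthogonalComplement.
Variables (C : numClosedFieldType) (n : nat).
Implicit Types (E U : {vspace 'cV[C]_n}) (x : 'cV[C]_n).

Local Notation orth := (orthov (@dotcv C n)).

(** Orthogonality to each vector of a basis of [E] costs at most one dimension, so the two disjoint
    summands are large enough to fill the space. *)
Lemma addv_orthov E : (E + orth E = fullv)%VS.
Proof.
have dim_orth s : (\dim {:'cV[C]_n} - size s <= \dim (orth <<s>>%VS))%N.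
  elim: s => [|u s IHs]; first by rewrite subn0 span_nil orthov0.
  apply: (@leq_trans (\dim (orth <<s>>%VS)).-1).
    by rewrite /= subnS -!subn1 leq_sub2r.
  apply: leq_trans (leq_dim_orthov1 (@dotcv C n) u _) _.
  by rewrite dimvS // span_cons orthovD capvSr capvSl.
apply/eqP; rewrite eqEdim subvf dimv_disjoint_sum ?orthov_disjoint //=.
have := dim_orth (vbasis E); rewrite size_tuple (span_basis (vbasisP E)).
by rewrite leq_subLR.
Qed.

(** [E1] is the orthogonal sum of [E2] and [E]; thus compressing to [E] amounts to working in [E1]
    modulo [E2]. *)
Lemma orth_proj_sub E1 E2 x (E := (E1 :&: orth E2)%VS) :
  (E2 <= E1)%VS -> x \in E1 -> x - orth_proj E x \in E2.
Proof.
move=> sE xE1; have : x \in (E2 + orth E2)%VS by rewrite addv_orthov memvf.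
case/memv_addP => e eE2 [y yo xe].
have yE : y \in E.
  by rewrite memv_cap yo andbT (canRL (addKr _) (esym xe)) addrC memvB // (subvP sE).
have eo : e \in orth E.
  by apply: (subvP _ _ eE2); rewrite orthov_sym capvSr.
by rewrite xe linearD /= (orth_proj_0 eo) (orth_proj_id yE) add0r addrK.
Qed.

Lemma dim_cap_orthov E1 E2 :
  (E2 <= E1)%VS -> \dim (E1 :&: orth E2) = (\dim E1 - \dim E2)%N.
Proof.
move=> sE.
have <- : (E2 + (orth E2 :&: E1) = E1)%VS by rewrite vspace_modl // addv_orthov capfv.
rewrite dimv_disjoint_sum; last first.
  by apply/eqP; rewrite -subv0 -(orthov_disjoint E2) capvS // capvSl.
by rewrite addKn vspace_modl // addv_orthov capfv capvC.
Qed.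

End OrthogonalComplement.

(** * Compressions to semi-invariant subspaces *)

Section Subquotients.
Variables (C : numClosedFieldType) (n : nat) (A : {vspace 'M[C]_n}).
Variables E1 E2 : {vspace 'cV[C]_n}.
Local Notation orth := (orthov (@dotcv C n)).
Let E := (E1 :&: orth E2)%VS.

Hypotheses (inv1 : invariant_subspace A E1) (inv2 : invariant_subspace A E2).
Hypothesis sE : (E2 <= E1)%VS.

(** The inner projection changes [b x] only by a vector of [E2]; [a] keeps it in [E2], which the
    outer projection kills. *)
Lemma compressM a b : a \in A -> b \in A ->
  compress E (a *m b) = (compress E a \o compress E b)%VF.
Proof.
move=> aA bA; apply/lfunP => x; apply/subvs_inj.
rewrite comp_lfunE !compressE -mulmxA; set y := b *m _.
have yE1 : y \in E1.
  by apply: inv1 => //; exact: (subvP (capvSl _ _) _ (subvsP x)).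
apply/eqP; rewrite -subr_eq0 -linearB /= -mulmxBr; apply/eqP/orth_proj_0.
have : a *m (y - orth_proj E y) \in E2 by exact/inv2/orth_proj_sub.
by apply: (subvP _ _); rewrite orthov_sym capvSr.
Qed.

(** A subspace [W] of [E] invariant under the compressions lifts to the [A]-invariant subspace
    [E2 + W], so the compressed algebra is irreducible. *)
Lemma subquotient_full : operator_algebra A -> (1 < \dim E)%N ->
    (forall W, (E2 <= W <= E1)%VS -> invariant_subspace A W -> W = E2 \/ W = E1) ->
  full_subquotient A E.
Proof.
move=> hA dE irr; apply: burnside; first by rewrite dimvf.
  move=> _ _ /mem_subquotientP[a aA ->] /mem_subquotientP[b bA ->].
  by apply/mem_subquotientP; exists (a *m b); rewrite ?compressM ?hA.
move=> W invW; pose iW := (linfun vsval @: W)%VS.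
have iWP w : w \in W -> vsval w \in iW.
  by move=> wW; apply/memv_imgP; exists w; rewrite // lfunE.
have iWE : (iW <= E)%VS.
  by apply/subvP => _ /memv_imgP[w _ ->]; rewrite lfunE subvsP.
have EE1 : (E <= E1)%VS by exact: capvSl.
have inE2 e : e \in E -> e \in E2 -> e = 0.
  move=> + eE2; rewrite memv_cap => /andP[_ eo].
  by apply/eqP; rewrite -memv0 -(orthov_disjoint E2) memv_cap eE2.
have [||W2|W1] := irr (E2 + iW)%VS.
- by rewrite addvSl subv_add sE (subv_trans iWE).
- move=> a _ aA /memv_addP[e eE2 [_ /memv_imgP[w wW ->] ->]].
  rewrite lfunE mulmxDr -(subrK (orth_proj E (a *m vsval w)) (a *m vsval w)).
  rewrite addrA memv_add //.
    by rewrite memvD ?inv2 // orth_proj_sub // inv1 // (subvP EE1) // subvsP.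
  by rewrite -compressE iWP // invW //; apply/mem_subquotientP; exists a.
- left; apply/eqP; rewrite -subv0; apply/subvP => w wW; rewrite memv0.
  apply/eqP/subvs_inj/inE2; first exact: subvsP.
  by rewrite -W2 (subvP (addvSr _ _)) // iWP.
right; apply/vspaceP => e; rewrite memvf.
have : vsval e \in (E2 + iW)%VS by rewrite W1 (subvP EE1) // subvsP.
case/memv_addP => f fE2 [_ /memv_imgP[w wW ->]]; rewrite lfunE => efw.
suff -> : e = w by [].
apply/subvs_inj/eqP; rewrite -subr_eq0; apply/eqP/inE2.
  by rewrite memvB ?subvsP.
by rewrite efw addrK.
Qed.

Lemma full_subquotient_commutator :
    full_subquotient A E -> (1 < \dim E)%N ->
  exists a, exists b, exists x, [/\ a \in A, b \in A, x \in E, x != 0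
    & (a *m b - b *m a) *m x - x \in E2].
Proof.
move=> fullE dE; have dS : (1 < \dim {:subvs_of E})%N by rewrite dimvf.
have [f [g [x [x0 fgx]]]] := lfun_commutator_fixes_vector dS.
have /mem_subquotientP[a aA fE] : f \in subquotient A E by rewrite fullE memvf.
have /mem_subquotientP[b bA gE] : g \in subquotient A E by rewrite fullE memvf.
have cx : compress E (a *m b - b *m a) x = x.
  by rewrite linearB /= !compressM // -fE -gE add_lfunE opp_lfunE !comp_lfunE.
exists a, b, (vsval x); split=> //; first exact: subvsP.
have cE1 : (a *m b - b *m a) *m vsval x \in E1.
  have xE1 : vsval x \in E1 := subvP (capvSl _ _) _ (subvsP x).
  by rewrite mulmxBl -!mulmxA memvB ?inv1.
by rewrite -{2}cx compressE; apply: orth_proj_sub.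
Qed.

End Subquotients.

Lemma mem_span_take (K : fieldType) (V : vectType K) m (b : m.-tuple V) k x :
  basis_of fullv b ->
  reflect (forall i : 'I_m, (k <= i)%N -> coord b i x = 0) (x \in <<take k b>>%VS).
Proof.
move=> bb; apply: (iffP idP) => [xk i ki|xk].
  suff /subvP/(_ x xk) : (<<take k b>> <= lker (linfun (coord b i : V -> K^o)))%VS.
    by rewrite memv_ker lfunE => /eqP.
  apply/span_subvP => v /(nthP 0)[j]; rewrite size_take_min leq_min => /andP[jk jb] <- {v}.
  rewrite size_tuple in jb; rewrite nth_take // memv_ker lfunE /=.
  rewrite (coord_free (Ordinal jb) i (basis_free bb)).
  by rewrite -val_eqE /= ltn_eqF // (leq_trans jk).
rewrite (coord_basis bb (memvf x)) memv_suml // => i _.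
have [/xk->|ik] := leqP k i; first by rewrite scale0r mem0v.
rewrite memvZ // memv_span // -(nth_take 0 ik) mem_nth //.
by rewrite size_take_min leq_min ik size_tuple ltn_ord.
Qed.

(** * Triangular form and flags of invariant subspaces *)

Section Flags.
Variables (C : numClosedFieldType) (n : nat) (A : {vspace 'M[C]_n}).
Local Notation orth := (orthov (@dotcv C n)).

Lemma triangularized_byP (b : n.-tuple 'cV[C]_n) : basis_of fullv b ->
  triangularized_by A b <-> forall k, invariant_subspace A <<take k b>>%VS.
Proof.
move=> bb; split=> [tA k a x aA /(mem_span_take _ _ bb) xk|inv a aA].
  rewrite (coord_basis bb (memvf x)) mulmx_sumr memv_suml // => j _.
  rewrite -scalemxAr; have [/xk->|jk] := leqP k j; first by rewrite scale0r mem0v.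
  rewrite memvZ //; apply/(mem_span_take _ _ bb) => i ki.
  have /upper_triangular_mxP/(_ i j (leq_trans jk ki)) := tA a aA.
  by rewrite mxE.
apply/upper_triangular_mxP => i j ji; rewrite mxE.
suff /(mem_span_take _ _ bb)-> : a *m b`_j \in <<take j.+1 b>>%VS by [].
apply: inv => //; rewrite memv_span // -(nth_take 0 (ltnSn j)) mem_nth //.
by rewrite size_take_min leq_min ltnSn size_tuple ltn_ord.
Qed.

(** Modulo [F] both operators act on [u] as scalars, and scalars commute. *)
Lemma commutator_lowers (F : {vspace 'cV[C]_n}) u a b v :
    invariant_subspace A F -> invariant_subspace A (F + <[u]>)%VS ->
    a \in A -> b \in A -> v \in (F + <[u]>)%VS ->
  (a *m b - b *m a) *m v \in F.
Proof.
move=> invF invU aA bA.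
have uU : u \in (F + <[u]>)%VS by rewrite (subvP (addvSr _ _)) // memv_line.
have /memv_addP[f1 f1F [_ /vlineP[x ->] au]] := invU a u aA uU.
have /memv_addP[f2 f2F [_ /vlineP[y ->] bu]] := invU b u bA uU.
case/memv_addP => f fF [_ /vlineP[t ->] ->].
rewrite mulmxDr -scalemxAr memvD ?memvZ // mulmxBl -!mulmxA.
  by rewrite memvB // !invF.
rewrite au bu !mulmxDr -!scalemxAr au bu !scalerDr !scalerA (mulrC y x).
rewrite [b *m f1 + _]addrA [a *m f2 + _]addrA opprD addrACA subrr addr0.
by rewrite memvB ?memvD ?memvZ ?invF.
Qed.

Lemma triangularized_no_full (b : n.-tuple 'cV[C]_n) (E : {vspace 'cV[C]_n}) :
    basis_of fullv b -> triangularized_by A b -> semi_invariant_subspace A E ->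
  full_subquotient A E -> (\dim E <= 1)%N.
Proof.
move=> bb /(triangularized_byP bb) inv [E1 [E2 [inv1 inv2 sE ->]]] fullE.
rewrite leqNgt; apply/negP => dE.
have [c [d [x [cA dA xE x0 cx]]]] := full_subquotient_commutator inv1 inv2 sE fullE dE.
(* Each step replaces [x] by its image under the commutator, equal to [x] modulo [E2], whose flag
   component drops one level. At [k = n] only [E2] remains. *)
have xk k : x \in (<<take (n - k) b>> + E2)%VS.
  elim: k => [|k IHk].
    rewrite subn0 take_oversize ?size_tuple // (span_basis bb).
    by rewrite (subvP (addvSl _ _)) ?memvf.
  rewrite subnS; case nk: (n - k)%N => [|m] /=; first by rewrite nk in IHk.
  have mb : (m < size b)%N by rewrite size_tuple -nk leq_subr.
  have bm : (<<take m.+1 b>> = <<take m b>> + <[b`_m]>)%VS.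
    by rewrite (take_nth 0 mb) -cats1 span_cat span_seq1.
  move: IHk; rewrite nk => /memv_addP[v vb [e eE2 xve]].
  rewrite -(subKr ((c *m d - d *m c) *m x) x) {1}xve mulmxDr -addrA memv_add //.
    by apply: (commutator_lowers (u := b`_m)); rewrite -?bm.
  by rewrite memvB // mulmxBl memvB // -!mulmxA !inv2.
have := xk n; rewrite subnn take0 span_nil add0v => xE2.
case/eqP: x0; apply/eqP; rewrite -memv0 -(orthov_disjoint E2) memv_cap xE2.
by move: xE; rewrite memv_cap => /andP[].
Qed.

Hypothesis hA : operator_algebra A.
Hypothesis no_full : ~ exists E : {vspace 'cV[C]_n},
  [/\ semi_invariant_subspace A E, full_subquotient A E & (1 < \dim E)%N].

(** Induction on the dimension of [E1]: an invariant subspace of intermediate dimension replaces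
    [E1]. If none exists and the gap exceeds 1, [subquotient_full] contradicts [no_full]. *)
Lemma invariant_cover (E1 E2 : {vspace 'cV[C]_n}) :
    invariant_subspace A E1 -> invariant_subspace A E2 ->
    (E2 <= E1)%VS -> (\dim E2 < \dim E1)%N ->
  exists W : {vspace 'cV[C]_n},
    [/\ invariant_subspace A W, (E2 <= W)%VS & \dim W = (\dim E2).+1].
Proof.
move=> + inv2; have [k] := ubnP (\dim E1).
elim: k E1 => // k IHk E1; rewrite ltnS => dk inv1 sE.
rewrite leq_eqVlt => /predU1P[d1|d2]; first by exists E1.
have [[W [invW sW dW]]|noW] := boolp.EM (exists W : {vspace 'cV[C]_n},
  [/\ invariant_subspace A W, (E2 <= W <= E1)%VS & (\dim E2 < \dim W < \dim E1)%N]).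
  have [/andP[sW2 _] /andP[dW2 dW1]] := (sW, dW).
  by apply: IHk invW sW2 dW2; apply: leq_trans dk.
have dE : (1 < \dim (E1 :&: orth E2))%N by rewrite dim_cap_orthov // ltn_subRL addn1.
case: no_full; exists (E1 :&: orth E2)%VS; split=> //; first by exists E1, E2.
apply: subquotient_full => // W /andP[sW2 sW1] invW.
have [/eqP|W2] := boolP (E2 == W); first by left.
have [/eqP|W1] := boolP (W == E1); first by right.
case: noW; exists W; split=> //; first by rewrite sW2.
rewrite !ltn_neqAle !dimvS // !andbT; apply/andP; split.
  by apply: contra W2 => /eqP dW; rewrite eqEdim sW2 dW /=.
by apply: contra W1 => /eqP dW; rewrite eqEdim sW1 dW /=.
Qed.

Lemma orthonormal_invariant_flag k : (k <= n)%N ->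
  exists s : seq 'cV[C]_n, [/\ size s = k, orthonormal (@dotcv C n) s
    & forall j, invariant_subspace A <<take j s>>%VS].
Proof.
elim: k => [_|k IHk kn].
  exists [::]; split=> // j a x aA; rewrite /= span_nil !memv0 => /eqP ->.
  by rewrite mulmx0.
have [s [sk os invs]] := IHk (ltnW kn).
have invS : invariant_subspace A <<s>>%VS by rewrite -[s]take_size.
have dS : \dim <<s>>%VS = k by apply/eqP; rewrite -sk; exact: orthonormal_free os.
have [||||W [invW sW dW]] := @invariant_cover fullv <<s>>%VS.
- by move=> *; apply: memvf.
- exact: invS.
- exact: subvf.
- by rewrite dS dimvf /dim /= muln1.
(* This intersection has dimension [k.+1 - k], so the picked vector is nonzero and can be
   normalized. *)
pose w := vpick (W :&: orth <<s>>%VS)%VS.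
have w0 : w != 0.
  by rewrite vpick0 -dimv_eq0 dim_cap_orthov // dW subSnn.
have /andP[wW ws] : (w \in W) && (w \in orth <<s>>%VS).
  by rewrite -memv_cap memv_pick.
pose u := (sqrtC (dotcv w w))^-1 *: w.
have uu : dotcv u u = 1.
  have ww := dotcv_gt0 w0; rewrite dnormZ ger0_norm ?invr_ge0 ?sqrtC_ge0 ?ltW //.
  by rewrite exprVn sqrtCK mulVf ?gt_eqF.
have us : u \in orth <<s>>%VS by rewrite memvZ.
have os' : orthonormal (@dotcv C n) (rcons s u).
  rewrite -cats1 orthonormal_cat os /= /orthonormal /= uu eqxx /=.
  apply/allP => v vs /=; rewrite andbT herm_eq0C.
  by apply/eqP/(mem_orthovP us)/memv_span.
exists (rcons s u); split=> //; first by rewrite size_rcons sk.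
(* Orthonormal vectors are free, so inclusion and equal dimension suffice; invariance of the new
   span comes from [W]. *)
have sW' : <<rcons s u>>%VS = W.
  apply/eqP; rewrite eqEdim; apply/andP; split.
    apply/span_subvP => v; rewrite mem_rcons => /predU1P[->|vs]; first by rewrite memvZ.
    by rewrite (subvP sW) // memv_span.
  have /eqP -> := orthonormal_free os'.
  by rewrite size_rcons sk dW dS.
move=> j; have [js|js] := leqP j k.
  by rewrite -cats1 takel_cat ?sk.
by rewrite take_oversize ?size_rcons ?sk // sW'.
Qed.

Lemma orthonormal_triangularization : exists2 b : n.-tuple 'cV[C]_n,
  orthonormal_basis b & triangularized_by A b.
Proof.
have [s [/eqP ns os invs]] := orthonormal_invariant_flag (leqnn n).
have bs : basis_of fullv (Tuple ns).
  rewrite basisEfree (orthonormal_free os) subvf /=.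
  by rewrite (eqP ns) dimvf /dim /= muln1.
exists (Tuple ns); first by rewrite /orthonormal_basis bs.
exact/(triangularized_byP bs).
Qed.

End Flags.

Theorem theorem5p1 (R : realType) (n : nat) (A : {vspace 'M[R[i]]_n})
    (hA : operator_algebra A) :
  [<-> exists2 b : n.-tuple 'cV[R[i]]_n,
         orthonormal_basis b & triangularized_by A b;
       exists2 b : n.-tuple 'cV[R[i]]_n,
         basis_of fullv b & triangularized_by A b;
       ~ exists E : {vspace 'cV[R[i]]_n},
           [/\ semi_invariant_subspace A E, full_subquotient A E
             & (1 < \dim E)%N]].
Proof.
split; first by case=> b /andP[bb _] tA; exists b.
split; last exact: orthonormal_triangularization.
case=> b bb tA [E [siE fullE]].
by rewrite ltnNge (triangularized_no_full bb tA siE fullE).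
Qed.
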